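(* Let $A\subseteq \mathbb{R}$. Then $C_p(H(A))$ is a Lindelöf $\Sigma$-space if and only if $\mathbb{R}\setminus A$ is countable.
   Context: For $A\subseteq\mathbb{R}$, the Hattori space $H(A)$ is the set $\mathbb{R}$ with the topology $\tau(A)$ in which a point $x\in A$ has the local base $\{(x-\varepsilon,x+\varepsilon) : \varepsilon>0\}$ and a point $x\in\mathbb{R}\setminus A$ has the local base $\{[x,x+\varepsilon) : \varepsilon>0\}$. $C_p(X)$ is the space of continuous real-valued functions on $X$ with the topology of pointwise convergence. A Tychonoff space $X$ is a Lindelöf $\Sigma$-space if there are a cover $\mathcal{C}$ of $X$ by compact sets and a countable family $\mathcal{N}$ of subsets of $X$ such that for every $C\in\mathcal{C}$ and every open $U\supseteq C$ there is $N\in\mathcal{N}$ with $C\subseteq N\subseteq U$. ''Countable'' means of cardinality at most $\aleph_0$. *)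

(* Defs.v *)
From HB Require Import structures.
From mathcomp Require Import all_boot all_order all_algebra.
From mathcomp Require Import all_classical all_reals all_analysis.

Set Implicit Arguments.
Unset Strict Implicit.
Unset Printing Implicit Defensive.

Import Order.TTheory GRing.Theory Num.Theory.
Import numFieldNormedType.Exports.

Local Open Scope classical_set_scope.
Local Open Scope ring_scope.

(* An alias of R, so that the Hattori topology does not clash with the
   Euclidean topology that R carries canonically. *)
Definition hattori (R : realType) (A : set R) : Type := R.

Section hattori_topology.
Context {R : realType} (A : set R).
Local Notation H := (hattori A).

HB.instance Definition _ := Choice.copy H R.

Definition hattori_base (x e : R) : set R :=
  if x \in A then `]x - e, x + e[%classic else `[x, x + e[%classic.

Definition hattori_nbhs (x : H) : set_system H :=
  [set U | exists2 e : R, 0 < e & hattori_base x e `<=` U].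

HB.instance Definition _ := hasNbhs.Build H hattori_nbhs.

Let hattori_base_refl (x e : R) : 0 < e -> hattori_base x e x.
Proof.
move=> e0; rewrite /hattori_base; case: ifP => _ /=.
  by rewrite in_itv/= ltrDl e0 ltrBlDr ltrDl e0.
by rewrite in_itv/= lexx ltrDl e0.
Qed.

Let hattori_base_le (x e d : R) :
  e <= d -> hattori_base x e `<=` hattori_base x d.
Proof.
move=> ed y; rewrite /hattori_base; case: ifP => _ /=;
  rewrite !in_itv/= => /andP[xy yx]; apply/andP; split => //.
- by apply: le_lt_trans xy; rewrite lerD2l lerN2.
- by apply: lt_le_trans yx _; rewrite lerD2l.
- by apply: lt_le_trans yx _; rewrite lerD2l.
Qed.

Let hattori_nbhs_filter (x : H) : ProperFilter (nbhs x).
Proof.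
apply: Build_ProperFilter_ex => [U [e e0 eU]|].
  by exists x; apply/eU/hattori_base_refl.
split=> [|U V [e e0 eU] [d d0 dV]|U V UV [e e0 eU]].
- by exists 1.
- exists (Num.min e d); first by rewrite lt_min e0.
  move=> y xy; split.
    by apply: eU; apply: hattori_base_le xy; rewrite ge_min lexx.
  by apply: dV; apply: hattori_base_le xy; rewrite ge_min lexx orbT.
- by exists e => //; exact: subset_trans UV.
Qed.

Let hattori_nbhs_singleton (x : H) (U : set H) : nbhs x U -> U x.
Proof. by case=> e e0; apply; exact: hattori_base_refl. Qed.

Let hattori_nbhs_itv (a b y : R) :
  a < y -> y < b -> nbhs (y : H) (`]a, b[%classic : set R).
Proof.
move=> ay yb; exists (Num.min (y - a) (b - y)).
  by rewrite lt_min !subr_gt0 ay.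
set e := Num.min _ _.
have ea : e <= y - a by rewrite ge_min lexx.
have eb : y + e <= b by rewrite -lerBrDl ge_min lexx orbT.
move=> z; rewrite /hattori_base; case: ifP => _ /=;
  rewrite !in_itv/= => /andP[yz zy]; rewrite (lt_le_trans zy eb) andbT.
  by apply: le_lt_trans yz; rewrite lerBrDr -lerBrDl.
exact: lt_le_trans yz.
Qed.

Let hattori_nbhs_nbhs (x : H) (U : set H) : nbhs x U -> nbhs x (nbhs^~ U).
Proof.
move=> /[dup] xU [e e0 eU]; exists e => // y.
have [xA|xA] := boolP ((x : R) \in A).
  rewrite /hattori_base xA /= in_itv/= => /andP[xy yx].
  apply: (@filterS _ _ (hattori_nbhs_filter y) _ _ _ (hattori_nbhs_itv xy yx)).
  by move=> z xz; apply: eU; rewrite /hattori_base xA.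
rewrite /hattori_base (negbTE xA) /= in_itv/= le_eqVlt.
move=> /andP[/orP[/eqP <- //|xy] yx].
apply: (@filterS _ _ (hattori_nbhs_filter y) _ _ _ (hattori_nbhs_itv xy yx)).
move=> z xz; apply: eU; rewrite /hattori_base (negbTE xA) /=.
by move: xz; rewrite /= !in_itv/= => /andP[/ltW -> ->].
Qed.

HB.instance Definition _ := Nbhs_isNbhsTopological.Build H
  hattori_nbhs_filter hattori_nbhs_singleton hattori_nbhs_nbhs.

End hattori_topology.

(* As a type, a set of {ptws X -> R} carries the subspace topology. *)
Definition Cp (R : realType) (X : topologicalType) : set {ptws X -> R} :=
  [set f | continuous (f : X -> R)].
Arguments Cp : clear implicits.

(* completely_regular_space is phrased through uniform_separator; by
   uniform_separatorP this is separation of a point from a closed set by a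
   continuous function into [0, 1]. *)
Definition tychonoff_space (X : topologicalType) : Prop :=
  accessible_space X /\ completely_regular_space X.

Definition lindelof_sigma_space (X : topologicalType) : Prop :=
  tychonoff_space X /\
  exists (C N : set (set X)),
    [/\ forall K, C K -> compact K,
        \bigcup_(K in C) K = [set: X],
        countable N &
        forall K U, C K -> open U -> K `<=` U ->
          exists M, [/\ N M, K `<=` M & M `<=` U]].

(* Main.v *)
(* Both directions go through countable networks.  A space with a countable
   network is Lindelof Sigma, the compact sets being the singletons, and Cp X
   has a countable network as soon as X has one.  Conversely, if X is separable
   then the sets {g | g d < r} and {g | g d > r}, with d in a countable dense
   set and r rational, separate the points of Cp X; intersecting finitely many
   of them with members of the family N turns a Lindelof Sigma structure on
   Cp X into a countable network.  For x outside A the indicator g_x of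
   [x, +oo) is continuous on H(A); members S_x of the network with
   g_x in S_x included in {g | g x != 0} are pairwise distinct, since
   g_y x = 0 for x < y. *)
From HB Require Import structures.
Require Import Defs.
From mathcomp Require Import all_boot all_order all_algebra.
From mathcomp Require Import finmap.
From mathcomp Require Import all_classical all_reals all_analysis.

Import Order.TTheory GRing.Theory Num.Theory.
Import numFieldNormedType.Exports.

Local Open Scope classical_set_scope.
Local Open Scope ring_scope.

Definition countable_network (X : topologicalType) : Prop :=
  exists2 P : set (set X), countable P &
    forall x (U : set X), open U -> U x -> exists S, [/\ P S, S x & S `<=` U].

(** For [x] in an open [U], take a compact [K] of the cover through [x]. The points of [K] outside
    [U] lie in sets [V i] with [W i x], and finitely many of these suffice. Some [M] in [N] lies
    between [K] and the union of [U] with these [V i]; cutting [M] by the matching [W i] removes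
    every [V i] and leaves a part of [U] around [x]. *)
Lemma lindelof_sigma_countable_network {X : topologicalType} (I : countType)
    (W V : I -> set X) :
  (forall i, open (V i)) -> (forall i, W i `&` V i = set0) ->
  (forall x y, x != y -> exists i, W i x /\ V i y) ->
  lindelof_sigma_space X -> countable_network X.
Proof.
move=> Vo WV sepWV [_ [C [N [Ccpt Ccov Ncnt CN]]]].
pose Ws (s : seq I) : set X := [set x | forall i, i \in s -> W i x].
exists (\bigcup_(M in N) range (fun s => M `&` Ws s)).
  apply: bigcup_countable => // M _.
  exact: sub_countable (card_image_le _ _) (countableP _).
move=> x U Uo Ux; have [K CK Kx] : (\bigcup_(K in C) K) x by rewrite Ccov.
(* The index [None] stands for [U], so that one family covers [K]. *)
pose D : set (option I) := [set o | if o is Some i then W i x else True].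
pose f (o : option I) := if o is Some i then V i else U.
have fo o : D o -> open (f o) by case: o => [i|] _ //=.
have Kf : K `<=` \bigcup_(o in D) f o.
  move=> y Ky; have [Uy|nUy] := pselect (U y); first by exists None.
  have /sepWV[i [Wx Vy]] : x != y by apply/eqP => xy; apply: nUy; rewrite -xy.
  by exists (Some i).
(* compact_cover requires a pointed space. *)
pose pX : ptopologicalType := HB.pack X (isPointed.Build X x).
have := Ccpt K CK.
rewrite -[compact K]/(@compact pX K) compact_cover.
move=> /(_ (option I) D f fo Kf)[s sD Ks].
pose t : seq I := pmap id (enum_fset s).
have mem_t i : (i \in t) = (Some i \in s).
  by rewrite /t mem_pmap map_id.
have UVo : open (U `|` \bigcup_(i in [set` t]) V i).
  by apply: openU => //; exact: bigcup_open.
have KUV : K `<=` U `|` \bigcup_(i in [set` t]) V i.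
  move=> y /Ks[[i|]/= si fy]; last by left.
  by right; exists i; rewrite //= mem_t.
have [M [NM KM MU]] := CN _ _ CK UVo KUV.
exists (M `&` Ws t); split.
- by exists M => //; exists t.
- split; first exact: KM.
  by move=> i; rewrite mem_t => /sD /set_mem.
- move=> y [/MU[//|[i /= ti Vy]] /(_ i ti) Wy].
  by have : (W i `&` V i) y by []; rewrite WV.
Qed.

Lemma countable_network_lindelof_sigma {X : topologicalType} :
  tychonoff_space X -> countable_network X -> lindelof_sigma_space X.
Proof.
move=> tX [P Pcnt Pnet]; split => //; exists (range set1), P; split => //.
- by move=> _ [x _ <-]; exact: compact_set1.
- by rewrite -subTset => x _; exists [set x] => //; exists x.
- move=> _ U [x _ <-] Uo xU.
  have [S [PS Sx SU]] := Pnet x U Uo (xU x erefl).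
  by exists S; split => // _ ->.
Qed.

Section function_space.
Context {R : realType} {X : topologicalType}.

Definition Cp_fun (g : Cp R X) : X -> R := set_val g.

Lemma Cp_continuous (g : Cp R X) : continuous (Cp_fun g).
Proof. by rewrite /Cp_fun; case: g => g /= gC; exact: (set_mem gC). Qed.

Definition Cp_mk (g : X -> R) (cg : continuous g) : Cp R X :=
  SigSub (mem_set (cg : Cp R X g)).

Lemma Cp_eval_continuous (x : X) : continuous (fun g : Cp R X => Cp_fun g x).
Proof.
move=> g; apply: (@continuous_comp _ _ _ (set_val : Cp R X -> {ptws X -> R})
  (fun h => h x)).
  exact: initial_continuous.
exact: (@proj_continuous X (fun=> R) x).
Qed.

Lemma Cp_cvg (F : set_system (Cp R X)) (g : Cp R X) : Filter F ->
  (forall x, Cp_fun h x @[h --> F] --> Cp_fun g x) -> F --> g.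
Proof.
move=> FF Fg.
have Fval : set_val @ F --> (set_val g : {ptws X -> R}).
  by apply/pointwise_cvgP => x; exact: Fg.
move=> U [_ [[V Vo <-] Vg VU]].
apply: filterS VU _; apply: (Fval V); exact: open_nbhs_nbhs.
Qed.

Lemma tychonoff_Cp : tychonoff_space (Cp R X).
Proof.
split; last exact: (@uniform_completely_regular R).
apply: hausdorff_accessible => g h gh; apply/val_inj/funext => x.
apply: (@Rhausdorff R) => U V Ug Vh.
have ev := Cp_eval_continuous x.
have [k [Uk Vk]] := gh _ _ (ev g _ Ug) (ev h _ Vh).
by exists (Cp_fun k x).
Qed.

Lemma lindelof_sigma_Cp_countable_network (I : countType) (d : I -> X) :
  dense (range d) -> lindelof_sigma_space (Cp R X) ->
  countable_network (Cp R X).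
Proof.
move=> dd.
(* The Boolean picks the side of the rational level, so negating it gives the opposite, disjoint
   half-space. *)
pose H (b : bool) (i : I * rat) : set (Cp R X) :=
  if b then [set g | Cp_fun g (d i.1) < ratr i.2]
  else [set g | ratr i.2 < Cp_fun g (d i.1)].
apply: (@lindelof_sigma_countable_network _ (bool * (I * rat))%type
  (fun i => H i.1 i.2) (fun i => H (~~ i.1) i.2)).
- move=> [b [i r]] /=.
  have /continuousP ce := Cp_eval_continuous (d i).
  case: b => /=.
    by have := ce _ (@open_gt R (ratr r)).
  by have := ce _ (@open_lt R (ratr r)).
- move=> [[] [i r]]; rewrite -subset0 => g [/= + gr] => /(lt_trans gr);
  by rewrite ltxx.
- move=> g h gh.
  have [x gx] : exists x, Cp_fun g x != Cp_fun h x.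
    apply: contrapT => /forallNP gheq; move/eqP: gh; apply.
    by apply/val_inj/funext => x; apply/eqP/negPn/negP/gheq.
  (* Two distinct continuous functions differ on a nonempty open set, hence at some [d i]; a
     rational between the two values separates them. *)
  pose O := [set x | Cp_fun g x - Cp_fun h x != 0].
  have Oo : open O.
    have /continuousP : continuous (fun x => Cp_fun g x - Cp_fun h x).
      by move=> z; apply: cvgB; exact: Cp_continuous.
    by move=> /(_ _ (@open_neq R 0)).
  have O0 : O !=set0 by exists x; rewrite /O /= subr_eq0.
  have [y [Oy [i _ iy]]] := dd O O0 Oo; move: Oy; rewrite -iy /O /= subr_eq0.
  rewrite neq_lt => /orP[] /rat_in_itvoo[r]; rewrite in_itv/= => /andP[ar rb].
    by exists (true, (i, r)).
  by exists (false, (i, r)).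
Qed.

(** A member of the new network is given by finitely many conditions that send a network set of [X]
    into a rational interval. *)
Lemma countable_network_Cp :
  countable_network X -> countable_network (Cp R X).
Proof.
move=> [P /countable_injP[e einj] Pnet].
pose E n : set X := xget set0 [set S | P S /\ e S = n].
have eE S : P S -> E (e S) = S.
  move=> PS; have [|PE eEE] := @xgetPex _ set0 [set T | P T /\ e T = e S].
    by exists S.
  by apply: einj eEE; exact/mem_set.
pose Q (s : seq (nat * (rat * rat))) : set (Cp R X) := [set g | forall t z,
  t \in s -> E t.1 z -> Cp_fun g z \in `]ratr t.2.1, ratr t.2.2[].
exists (range Q).
  exact: sub_countable (card_image_le _ _) (countableP _).
move=> g U Uo Ug.
(* The sets [Q s] containing [g] generate [F]. Convergence of [F] to [g], which can be checked
   pointwise, puts one of them inside [U]. *)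
pose F : set_system (Cp R X) := [set A | exists2 s, Q s g & Q s `<=` A].
have FF : Filter F.
  split=> [|A B [s sg sA] [t tg tB]|A B AB [s sg sA]].
  - by exists [::].
  - exists (s ++ t).
      by move=> u z; rewrite mem_cat => /orP[/sg|/tg]; exact.
    move=> h hst; split.
      by apply: sA => u z us; apply: hst; rewrite mem_cat us.
    by apply: tB => u z ut; apply: hst; rewrite mem_cat ut orbT.
  - by exists s => //; exact: subset_trans AB.
suff /(_ U (open_nbhs_nbhs (conj Uo Ug)))[s sg sU] : F --> g.
  by exists (Q s); split => //; exists s.
apply: Cp_cvg => x V /nbhs_ballP[eps /= eps0 epsV].
have [a] : exists a : rat, ratr a \in `]Cp_fun g x - eps, Cp_fun g x[.
  by apply: rat_in_itvoo; rewrite ltrBlDr ltrDl.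
have [b] : exists b : rat, ratr b \in `]Cp_fun g x, Cp_fun g x + eps[.
  by apply: rat_in_itvoo; rewrite ltrDl.
rewrite !in_itv/= => /andP[gb beps] /andP[aeps ag].
have /continuousP/(_ _ (@itv_open _ R (ratr a) (ratr b))) go :=
  Cp_continuous g.
have [|S [PS Sx Sab]] := Pnet x _ go; first by rewrite /= in_itv/= ag.
exists [:: (e S, (a, b))].
  by move=> u z; rewrite inE => /eqP ->; rewrite /= eE // => /Sab.
move=> h /(_ (e S, (a, b)) x (mem_head _ _)); rewrite /= eE // => /(_ Sx).
rewrite in_itv/= => /andP[ah hb]; apply: epsV.
rewrite /ball/= ltr_distlC; apply/andP; split.
  exact: lt_trans ah.
exact: lt_trans beps.
Qed.

End function_space.

Section hattori_space.
Context {R : realType} (A : set R).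

(** Basic neighbourhoods of both kinds contain some []x, x + e[]. *)
Lemma dense_hattori_rat : dense (range (ratr : rat -> hattori A)).
Proof.
move=> O [x Ox]; rewrite openE => /(_ _ Ox)[e e0 eO].
have [|q] := @rat_in_itvoo _ x (x + e); first by rewrite ltrDl.
rewrite in_itv/= => /andP[xq qe]; exists (ratr q); split; last by exists q.
apply: eO; rewrite /hattori_base; case: ifP => _; rewrite /= in_itv/= qe.
  by rewrite (lt_trans _ xq)// ltrBlDr ltrDl.
by rewrite ltW.
Qed.

Lemma countable_network_hattori :
  countable (~` A) -> countable_network (hattori A).
Proof.
move=> cA.
exists (range (fun q : rat * rat => `]ratr q.1, ratr q.2[%classic : set R) `|`
  \bigcup_(x in ~` A) range (fun q : rat => `[x, ratr q[%classic : set R)).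
  rewrite -bigcup2E; apply: bigcup_countable => // -[|[|i]] _ //=.
    exact: sub_countable (card_image_le _ _) (countableP _).
  apply: bigcup_countable => // x _.
  exact: sub_countable (card_image_le _ _) (countableP _).
move=> x U; rewrite openE => /[apply] -[e e0].
have [|q] := @rat_in_itvoo _ (x : R) (x + e); first by rewrite ltrDl.
rewrite in_itv/= => /andP[xq qe].
rewrite /hattori_base; case: ifPn => [xA|/negP xA] eU.
  have [|p] := @rat_in_itvoo _ (x - e) (x : R); first by rewrite ltrBlDr ltrDl.
  rewrite in_itv/= => /andP[ep px].
  exists (`]ratr p, ratr q[%classic); split; first by left; exists (p, q).
    by rewrite /= in_itv/= px.
  move=> y /=; rewrite in_itv/= => /andP[py yq]; apply: eU.
  by rewrite /= in_itv/= (lt_trans ep py) (lt_trans yq qe).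
exists (`[x : R, ratr q[%classic); split.
- right; exists x; last by exists q.
  by move=> Ax; apply: xA; exact: mem_set.
- by rewrite /= in_itv/= lexx.
- move=> y /=; rewrite in_itv/= => /andP[xy yq]; apply: eU.
  by rewrite /= in_itv/= xy (lt_trans yq qe).
Qed.

Lemma continuous_indic_ge (x : R) :
  ~ A x -> continuous (\1_`[x, +oo[%classic : hattori A -> R).
Proof.
move=> nAx y.
suff /(@cvg_near_cst (hattori A)) : nbhs y [set z : hattori A |
    \1_`[x, +oo[%classic z = \1_`[x, +oo[%classic y :> R] by exact.
(* The indicator is locally constant: away from [x] the distance to [x] serves as radius, and at [x]
   any radius does, since basic neighbourhoods of a point outside [A] do not reach to its left. *)
have [yx|xy|->] := ltgtP (y : R) x.
- exists (x - y); first by rewrite /= subr_gt0.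
  have yE : (y : R) + (x - y) = x by rewrite addrC subrK.
  move=> z; rewrite /hattori_base; case: ifP => _ /=;
  by rewrite in_itv/= yE !indicE !mem_setE !in_itv/= !andbT
    => /andP[_ /lt_geF ->]; rewrite (lt_geF yx).
- exists (y - x); first by rewrite /= subr_gt0.
  move=> z; rewrite /hattori_base; case: ifP => _ /=.
    rewrite in_itv/= subKr !indicE !mem_setE !in_itv/= !andbT.
    by move=> /andP[/ltW -> _]; rewrite (ltW xy).
  rewrite in_itv/= !indicE !mem_setE !in_itv/= !andbT.
  by move=> /andP[/(le_trans (ltW xy)) -> _]; rewrite (ltW xy).
- exists 1 => //= z; rewrite /hattori_base memNset // /= in_itv/=.
  by rewrite !indicE !mem_setE !in_itv/= !andbT lexx => /andP[-> _].
Qed.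

Lemma countable_setC_of_Cp_hattori_network :
  countable_network (Cp R (hattori A)) -> countable (~` A).
Proof.
move=> [P /countable_injP[e einj] Pnet].
pose U x : set (Cp R (hattori A)) := [set g | Cp_fun g x != 0].
(* Choice needs a value at every real; [set0] is a dummy on [A]. *)
have /choice[S SP] x : exists S, ~ A x -> [/\ P S, S `<=` U x &
    exists2 g, S g & forall y : R, y < x -> Cp_fun g y = 0].
  have [Ax|nAx] := pselect (A x); first by exists set0.
  pose g := Cp_mk _ (continuous_indic_ge x nAx).
  have Uo : open (U x).
    have /continuousP := Cp_eval_continuous (R := R) (X := hattori A) x.
    by move=> /(_ _ (@open_neq R 0)).
  have Ux : U x g.
    by rewrite /U /= /Cp_fun set_valE /= indicE mem_setE in_itv/= lexx oner_eq0.
  have [S [PS Sg SU]] := Pnet g _ Uo Ux; exists S => _; split => //.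
  exists g => // y yx.
  by rewrite /Cp_fun set_valE /= indicE mem_setE in_itv/= andbT lt_geF.
apply/countable_injP; exists (e \o S).
(* Were the two sets equal, the function chosen for [y] would lie in [U x] although it vanishes at
   [x]. *)
have Slt x y : ~ A x -> ~ A y -> x < y -> e (S x) <> e (S y).
  move=> nAx nAy xy exy.
  have [PSx SUx _] := SP x nAx; have [PSy _ [g Sg /(_ x xy) gx]] := SP y nAy.
  have SE : S x = S y by apply: einj exy; exact: mem_set.
  by have := SUx g; rewrite SE => /(_ Sg); rewrite /U /= gx eqxx.
move=> x y /set_mem nAx /set_mem nAy /= exy.
by case: (ltgtP x y) => // xy; [have := Slt x y|have := Slt y x];
  move=> /(_ _ _ _) H; case: H.
Qed.

End hattori_space.

Theorem theorem8 (R : realType) (A : set R) :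
  lindelof_sigma_space (Cp R (hattori A)) <-> countable (~` A).
Proof.
split=> [/(lindelof_sigma_Cp_countable_network _ _ (dense_hattori_rat A))|].
  exact: countable_setC_of_Cp_hattori_network.
move=> /countable_network_hattori /(@countable_network_Cp R).
exact: countable_network_lindelof_sigma tychonoff_Cp.
Qed.
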